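(* There exist universal constants $c_1,c_2>0$ such that the following holds. Let $X_1,\dots,X_n$ be i.i.d. real random variables with cumulative distribution function $F$ and empirical cumulative distribution function $F_n$. Then for any $x_0\le x_1$ in $\mathbb R\cup\{\pm\infty\}$ and any $t\ge0$, letting $V=\sup_{x\in[x_0,x_1]}F(x)(1-F(x))$, $$\mathbb P\left(\sup_{x\in[x_0,x_1]}|F_n(x)-F(x)|>t\sqrt{\frac Vn}\right)\le c_1e^{-c_2\min(t^2,\,t\sqrt{nV})}.$$
   Context: $F(x)=\mathbb P(X_1\le x)$ and $F_n(x)=\frac1n\sum_{i=1}^n\mathbf 1(X_i\le x)$, with the conventions $F(-\infty)=F_n(-\infty)=0$ and $F(+\infty)=F_n(+\infty)=1$. The interval $[x_0,x_1]$ is taken in the extended real line. *)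

(* Defs.v *)
From mathcomp Require Import all_boot all_order all_algebra.
From mathcomp Require Import all_classical all_reals all_analysis.

Set Implicit Arguments.
Unset Strict Implicit.
Unset Printing Implicit Defensive.

Import Order.TTheory GRing.Theory Num.Theory.

Local Open Scope classical_set_scope.
Local Open Scope ring_scope.

Definition mutually_independent d (T : measurableType d) (R : realType)
    (P : probability T R) (n : nat) (X : 'I_n -> {RV P >-> R}) : Prop :=
  forall (J : {set 'I_n}) (A : 'I_n -> set R),
    (forall i, i \in J -> measurable (A i)) ->
    P (\bigcap_(i in [set` J]) (X i @^-1` A i)) =
      (\prod_(i in J) P (X i @^-1` A i))%E.

(* The laws are compared on measurable sets only: the value that a measure
   takes on a non-measurable set carries no meaning. *)
Definition identically_distributed d (T : measurableType d) (R : realType)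
    (P : probability T R) (n : nat) (X : 'I_n -> {RV P >-> R}) : Prop :=
  forall (i j : 'I_n) (A : set R), measurable A ->
    distribution P (X i) A = distribution P (X j) A.

Definition iid d (T : measurableType d) (R : realType)
    (P : probability T R) (n : nat) (X : 'I_n -> {RV P >-> R}) : Prop :=
  mutually_independent X /\ identically_distributed X.

Definition ecdf d (T : measurableType d) (R : realType)
    (P : probability T R) (n : nat) (X : 'I_n -> {RV P >-> R})
    (w : T) (x : R) : R :=
  n%:R^-1 * \sum_(i < n) (X i w <= x)%R%:R.

Definition extend_cdf (R : realType) (G : R -> R) (x : \bar R) : R :=
  match x with
  | r%:E%E => G r
  | +oo%E => 1
  | -oo%E => 0
  end.

(* The suprema below are taken in R; for x0 <= x1 they range over nonempty
   subsets of [0, 1]. *)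
Definition max_variance (R : realType) (F : \bar R -> R) (x0 x1 : \bar R) : R :=
  sup [set F x * (1 - F x) | x in `[x0, x1]].

Definition sup_distance (R : realType) (G F : \bar R -> R) (x0 x1 : \bar R)
    : R :=
  sup [set `|G x - F x| | x in `[x0, x1]].

(* Main.v *)
Require Import Defs.
From mathcomp Require Import all_boot all_order all_algebra.
From mathcomp Require Import all_classical all_reals all_analysis.
From mathcomp Require Import ring lra.
Import Order.TTheory GRing.Theory Num.Theory.
Import numFieldNormedType.Exports.
Local Open Scope classical_set_scope.
Local Open Scope ring_scope.
Set Implicit Arguments.
Unset Strict Implicit.
Unset Printing Implicit Defensive.

(* A chain of nested events [B 0, B 1, ...] of probabilities [G j], observed on
   an i.i.d. sample, makes [M j = sum_i (1 - 1(X_i in B j) / G j)] a martingale,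
   and the deviation of the number of [X_i] in [B j] from its mean is
   [- G j * M j]. Doob's maximal inequality for [expR (lam * M j)] thus bounds
   the largest deviation along the chain by the exponential moment of the last
   [M j], which is controlled by the variance [G j * (1 - G j)] when
   [G j >= 1/2]. The events [X > x] with [F x <= 1/2], and the events [X <= x]
   with [F x > 1/2], are two such chains; by right-continuity they need only be
   taken over countably many [x], hence, by monotone limits, over finite grids.
   The martingale argument is carried out on the finite space recording which
   events of the chain contain each [X_i]. *)

(** Inverting [1 - u <= expR (- u)] gives [expR u <= (1 - u)^-1], and the quadratic times [1 - u] is
    [1 + u ^+ 2 * (1 - 2 * u) >= 1]. *)
Lemma expR_le_quadratic (R : realType) (u : R) : `|u| <= 2^-1 ->
  expR u <= 1 + u + 2 * u ^+ 2.
Proof.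
rewrite ler_norml => /andP[u_ge u_le].
have u1 : 0 < 1 - u by lra.
apply: (@le_trans _ _ (1 - u)^-1).
  rewrite -[leLHS]invrK -expRN lef_pV2 ?posrE ?expR_gt0 //.
  exact: expR_ge1Dx.
rewrite -[leLHS]mul1r ler_pdivrMr //; nra.
Qed.

(** * Doob's inequality for nested events on a finite product space *)

Section NestedMartingale.
Variables (R : realType) (K : finType) (n : nat) (p : K -> R).
Hypotheses (p_ge0 : forall k, 0 <= p k) (p_sum1 : \sum_k p k = 1).

Local Notation config := {ffun 'I_n -> K}.

Definition weight (c : config) : R := \prod_i p (c i).

Definition replace (c : config) (i : 'I_n) (k : K) : config :=
  [ffun x => if x == i then k else c x].

Lemma weight_ge0 c : 0 <= weight c.
Proof. exact: prodr_ge0. Qed.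

(* [(c, k) |-> (replace c i k, c i)] is an involution that preserves
   [weight c * p k]. *)
Lemma sum_weight_replace (i : 'I_n) (f : config -> R) :
  \sum_c weight c * f c = \sum_c weight c * \sum_k p k * f (replace c i k).
Proof.
have -> : \sum_c weight c * f c = \sum_c \sum_k weight c * p k * f c.
  apply: eq_bigr => c _.
  by rewrite -mulr_suml -mulr_sumr p_sum1 mulr1.
under [RHS]eq_bigr do rewrite mulr_sumr.
rewrite !pair_big /=.
pose h (u : config * K) := (replace u.1 i u.2, u.1 i).
have hK : involutive h.
  move=> [c k]; rewrite /h /= ffunE eqxx; congr (_, _).
  by apply/ffunP => x; rewrite !ffunE; case: eqP => // ->.
rewrite (reindex_inj (inv_inj hK)) /=; apply: eq_bigr => -[c k] _ /=.
rewrite mulrA; congr (_ * _); rewrite /weight (bigD1 i) //=.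
rewrite [in RHS](bigD1 i) //= ffunE eqxx.
rewrite [LHS]mulrC mulrA [RHS]mulrAC; congr (_ * _).
by apply: eq_bigr => j /negPf ji; rewrite ffunE ji.
Qed.

Variable B : nat -> pred K.
Hypothesis B_nested : forall i j k, (i <= j)%N -> B j k -> B i k.

Definition mass j : R := \sum_(k | B j k) p k.

(* The martingale, centred and normalised so that its [i]-th term stops
   moving once [c i] has left [B j]. *)
Definition mart j (c : config) : R :=
  \sum_(i < n) (1 - (B j (c i))%:R / mass j).

Lemma mass_anti i j : (i <= j)%N -> mass j <= mass i.
Proof.
move=> ij; rewrite /mass [leLHS]big_mkcond [leRHS]big_mkcond.
apply: ler_sum => k _; case: ifPn => [/(B_nested ij) ->//|_].
by case: ifP.
Qed.

Lemma mass_le1 j : mass j <= 1.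
Proof.
rewrite -p_sum1 /mass big_mkcond; apply: ler_sum => k _.
by case: ifP.
Qed.

Lemma sum_indic_mass j : \sum_k p k * (B j k)%:R = mass j.
Proof.
rewrite /mass [RHS]big_mkcond; apply: eq_bigr => k _.
by case: ifP; rewrite ?mulr1 ?mulr0.
Qed.

(** Martingale property, tested against a function [g] of the past. Resampling one coordinate
    suffices: its increment vanishes off [B j], and inside [B j] the past does not tell points
    apart, so [g] factors out of a sum of mean zero. *)
Lemma mart_orthogonal j J (g : config -> R) : (j <= J)%N -> 0 < mass J ->
  (forall c c' : config, (forall i l, (l <= j)%N -> B l (c i) = B l (c' i)) ->
    g c = g c') ->
  \sum_c weight c * (g c * (mart J c - mart j c)) = 0.
Proof.
move=> jJ GJ gP.
have Gj : 0 < mass j := lt_le_trans GJ (mass_anti jJ).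
pose h k := (B j k)%:R / mass j - (B J k)%:R / mass J.
have -> : \sum_c weight c * (g c * (mart J c - mart j c)) =
    \sum_(i < n) \sum_c weight c * (g c * h (c i)).
  rewrite exchange_big; apply: eq_bigr => c _.
  rewrite -!mulr_sumr -sumrB; congr (_ * (_ * _)).
  by apply: eq_bigr => i _; rewrite /h; ring.
apply: big1 => i _; rewrite (sum_weight_replace i) big1 // => c _.
under eq_bigr do rewrite ffunE eqxx.
have [k0 k0j|j0] := pickP (B j); last first.
  rewrite big1 ?mulr0 // => k _.
  have -> : h k = 0; last by rewrite !mulr0.
    rewrite /h (j0 k); case: (boolP (B J k)) => [/(B_nested jJ)|_].
      by rewrite j0.
    by rewrite !mul0r subrr.
suff -> : \sum_k p k * (g (replace c i k) * h k) =
    g (replace c i k0) * \sum_k p k * h k.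
  under eq_bigr do rewrite /h mulrBr !mulrA.
  by rewrite sumrB -!mulr_suml !sum_indic_mass !divff ?gt_eqF // subrr !mulr0.
rewrite mulr_sumr; apply: eq_bigr => k _; rewrite mulrCA.
have [kj|kj] := boolP (B j k); last first.
  suff -> : h k = 0 by rewrite !mulr0.
  rewrite /h (negPf kj) (_ : B J k = false) ?mul0r ?subrr //.
  by apply: contraNF kj; exact: B_nested.
congr (_ * _); apply: gP => x l lj; rewrite !ffunE; case: ifP => // _.
by rewrite (B_nested lj kj) (B_nested lj k0j).
Qed.

Definition crossed (lam b : R) j (c : config) : bool :=
  [exists l : 'I_j.+1, b <= lam * mart l c].

Lemma crossedS lam b j c :
  crossed lam b j.+1 c = crossed lam b j c || (b <= lam * mart j.+1 c).
Proof.
apply/existsP/orP => [[l bl]|[/existsP[l bl]|bj]].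
- case: (unliftP ord_max l) bl => [i ->|->] bl; last by right.
  by left; apply/existsP; exists i; rewrite lift_max in bl.
- by exists (widen_ord (leqnSn _) l).
- by exists ord_max.
Qed.

Lemma mart_local j (c c' : config) :
  (forall i, B j (c i) = B j (c' i)) -> mart j c = mart j c'.
Proof. by move=> cc'; apply: eq_bigr => i _; rewrite cc'. Qed.

(* Doob's maximal inequality. Convexity of [expR] is used through the
   tangent bound [expR (x + y) >= expR x * (1 + y)]. *)
Lemma mart_maximal (lam b : R) j : 0 < mass j ->
  expR b * \sum_(c | crossed lam b j c) weight c <=
  \sum_(c | crossed lam b j c) weight c * expR (lam * mart j c).
Proof.
elim: j => [|j IH] Gj.
  rewrite mulr_sumr; apply: ler_sum => c /existsP[l].
  rewrite ord1 => bl; rewrite mulrC ler_wpM2l ?weight_ge0 //.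
  by rewrite ler_expR.
have {}IH := IH (lt_le_trans Gj (mass_anti (leqnSn j))).
(* Crossings by time [j.+1] are either old, left to the induction, or first crossings, where the
   bound holds termwise. *)
have split (F : config -> R) : \sum_(c | crossed lam b j.+1 c) F c =
    \sum_(c | crossed lam b j c) F c +
    \sum_(c | ~~ crossed lam b j c && (b <= lam * mart j.+1 c)) F c.
  rewrite (bigID (crossed lam b j)) /=; congr (_ + _); apply: eq_bigl => c;
    rewrite crossedS; by case: (crossed _ _ _ _); rewrite ?andbT ?andbF.
rewrite !split mulrDr lerD //; last first.
  rewrite mulr_sumr; apply: ler_sum => c /andP[_ bl].
  by rewrite mulrC ler_wpM2l ?weight_ge0 // ler_expR.
apply: le_trans IH _.
(* [g] is the slope of the tangent bound on already crossed paths; by orthogonality the linear term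
   sums to zero and can be added for free. *)
pose g c := (crossed lam b j c)%:R * (lam * expR (lam * mart j c)).
have g_local (c c' : config) :
    (forall i l, (l <= j)%N -> B l (c i) = B l (c' i)) -> g c = g c'.
  move=> cc'; rewrite /g (_ : mart j c = mart j c'); last first.
    by apply: mart_local => i; exact: cc'.
  congr (_%:R * _); rewrite /crossed; congr (nat_of_bool _).
  apply: eq_existsb => l.
  by rewrite (_ : mart l c = mart l c') //; apply: mart_local => i;
    apply: cc'; rewrite -ltnS.
have := mart_orthogonal (leqnSn j) Gj g_local.
rewrite [X in X = 0 -> _](bigID (crossed lam b j)) /=.
rewrite [X in _ + X = 0 -> _]big1 ?addr0; last first.
  by move=> c /negPf cN; rewrite /g cN !mul0r mulr0.
move=> E0; rewrite -[leLHS]addr0 -[X in _ + X]E0 -big_split /=.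
apply: ler_sum => c cr; rewrite -mulrDr ler_wpM2l ?weight_ge0 //.
rewrite /g cr mul1r.
set x := lam * mart j c.
have -> : lam * mart j.+1 c = x + lam * (mart j.+1 c - mart j c).
  by rewrite /x; ring.
rewrite expRD; set y := lam * (_ - _).
have -> : expR x + lam * expR x * (mart j.+1 c - mart j c) =
  expR x * (1 + y) by rewrite /y; ring.
by rewrite ler_wpM2l ?expR_ge0 // expR_ge1Dx.
Qed.

Lemma mart_mgf (lam : R) j : `|lam| <= 2^-1 -> 2^-1 <= mass j ->
  \sum_c weight c * expR (lam * mart j c) <=
  expR (8 * n%:R * lam ^+ 2 * (mass j * (1 - mass j))).
Proof.
move=> lam2 Gj; set G := mass j.
have G0 : 0 < G by rewrite (lt_le_trans _ Gj) // invr_gt0.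
have G1 : G <= 1 := mass_le1 j.
have iG2 : G^-1 <= 2 by rewrite -[leRHS]invrK lef_pV2 ?posrE ?invr_gt0.
have iG1 : 1 <= G^-1 by rewrite -[leLHS]invr1 lef_pV2 ?posrE.
pose u k := 1 - (B j k)%:R / G.
have -> : \sum_c weight c * expR (lam * mart j c) =
    \sum_(c : config) \prod_i (p (c i) * expR (lam * u (c i))).
  apply: eq_bigr => c _; rewrite big_split /= mulr_sumr expR_sum.
  by congr (_ * _).
rewrite -(bigA_distr_bigA (fun=> fun k => p k * expR (lam * u k))) /=.
have -> : 8 * n%:R * lam ^+ 2 * (G * (1 - G)) =
  n%:R * (8 * lam ^+ 2 * (G * (1 - G))) by ring.
rewrite prodr_const card_ord expRM_natl lerXn2r ?nnegrE ?expR_ge0 //.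
  by apply: sumr_ge0 => k _; rewrite mulr_ge0 ?expR_ge0.
apply: le_trans (expR_ge1Dx _).
apply: (@le_trans _ _
  (\sum_k p k * (1 + lam * u k + 2 * (lam * u k) ^+ 2))).
  apply: ler_sum => k _; rewrite ler_wpM2l // expR_le_quadratic //.
  rewrite normrM (le_trans _ lam2) // ler_piMr //.
  (* [u k] is 1 off [B j] and [1 - G^-1] on it, which is at least -1 because [G >= 1/2]. *)
  by rewrite /u ler_norml; case: (B j k); rewrite ?mul1r ?mul0r; lra.
have -> : \sum_k p k * (1 + lam * u k + 2 * (lam * u k) ^+ 2) =
    \sum_k ((1 + lam + 2 * lam ^+ 2) * p k +
      (- lam * G^-1 - 4 * lam ^+ 2 * G^-1 + 2 * lam ^+ 2 * G^-1 ^+ 2) *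
      (p k * (B j k)%:R)).
  apply: eq_bigr => k _; rewrite /u.
  by case: (B j k) => /=; ring.
rewrite big_split /= -!mulr_sumr sum_indic_mass p_sum1 -/G.
have GK : G^-1 * G = 1 by rewrite mulVf ?gt_eqF.
have -> : (1 + lam + 2 * lam ^+ 2) * 1 +
    (- lam * G^-1 - 4 * lam ^+ 2 * G^-1 + 2 * lam ^+ 2 * G^-1 ^+ 2) * G =
    1 + lam ^+ 2 * (2 * (G^-1 - 1)).
  by field; rewrite gt_eqF.
have -> : 8 * lam ^+ 2 * (G * (1 - G)) = lam ^+ 2 * (8 * (G * (1 - G))).
  by ring.
rewrite lerD2l ler_wpM2l ?sqr_ge0 //.
(* Since [G >= 1/2], [(1 - G) / G <= 4 * (G * (1 - G))], whence the factor 8. *)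
have -> : G^-1 - 1 = (1 - G) * G^-1 by rewrite mulrBl mul1r divff ?gt_eqF.
nra.
Qed.

(** Chernoff's bound for [lam] and [- lam], through the maximal inequality: a large absolute value
    makes one of the two signed paths reach [lam * a]. *)
Lemma mart_deviation (lam a V : R) j : 0 <= lam <= 2^-1 -> 2^-1 <= mass j ->
  mass j * (1 - mass j) <= V ->
  \sum_(c | [exists l : 'I_j.+1, a <= `|mart l c|]) weight c <=
  2 * expR (8 * n%:R * lam ^+ 2 * V - lam * a).
Proof.
move=> /andP[lam0 lam2] Gj GV.
have Gj0 : 0 < mass j by rewrite (lt_le_trans _ Gj) // invr_gt0.
have one_sided s : s ^+ 2 = lam ^+ 2 -> `|s| = lam ->
    \sum_(c | crossed s (lam * a) j c) weight c <=
    expR (8 * n%:R * lam ^+ 2 * V - lam * a).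
  move=> s2 sE; rewrite expRD expRN ler_pdivlMr ?expR_gt0 // mulrC.
  apply: le_trans (mart_maximal s (lam * a) Gj0) _.
  apply: (@le_trans _ _ (\sum_c weight c * expR (s * mart j c))).
    rewrite [leRHS](bigID (crossed s (lam * a) j)) /= lerDl.
    by apply: sumr_ge0 => c _; rewrite mulr_ge0 ?weight_ge0 ?expR_ge0.
  apply: le_trans (mart_mgf _ Gj) _; first by rewrite sE.
  by rewrite s2 ler_expR ler_wpM2l // mulr_ge0 ?sqr_ge0 // mulr_ge0.
rewrite mulr2n mulrDl !mul1r.
have lamE : `|lam| = lam := ger0_norm lam0.
have := lerD (one_sided lam erefl lamE)
  (one_sided (- lam) (sqrrN lam) (etrans (normrN lam) lamE)).
apply: le_trans; rewrite [X in X + _]big_mkcond [X in _ + X]big_mkcond.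
rewrite -big_split [leLHS]big_mkcond /=; apply: ler_sum => c _.
have w0 := weight_ge0 c.
case: existsP => [[l al]|_]; last by rewrite addr_ge0 //; case: ifP.
have [m0|m0] := leP 0 (mart l c).
  rewrite ger0_norm // in al.
  rewrite (_ : crossed lam _ _ _ = true) ?lerDl; first by case: ifP.
  by apply/existsP; exists l; rewrite ler_wpM2l.
rewrite ltr0_norm // in al.
rewrite (_ : crossed (- lam) _ _ _ = true) ?lerDr; first by case: ifP.
by apply/existsP; exists l; rewrite mulNr -mulrN ler_wpM2l.
Qed.

End NestedMartingale.

(** * Transfer from the finite product space to i.i.d. random variables *)

Lemma measure_preimage_finType d (T : measurableType d) (R : realType)
    (mu : {measure set T -> \bar R}) (K : finType) (f : T -> K)
    (mf : forall k, measurable (f @^-1` [set k])) (A : pred K) :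
  measurable (f @^-1` [set k | A k]) /\
  mu (f @^-1` [set k | A k]) = (\sum_(k | A k) mu (f @^-1` [set k]))%E.
Proof.
have -> : f @^-1` [set k | A k] =
    \bigcup_(k in [set k | A k]) f @^-1` [set k].
  by apply/seteqP; split=> [t At|t [k Ak /= ->]] //; exists (f t).
have fA : finite_set [set k | A k] by exact: finite_finset.
split; first exact: fin_bigcup_measurable.
rewrite measure_fin_bigcup //; last by move=> i j _ _ [t [/= <- <-]].
symmetry; apply: bigfs; first exact: index_enum_uniq.
by move=> k _; rewrite mem_index_enum.
Qed.

Section NestedDeviation.
Context d (T : measurableType d) (R : realType) (P : probability T R) (n : nat).
Variables (X : 'I_n -> {RV P >-> R}) (i0 : 'I_n).
Hypothesis X_iid : iid X.
Variables (J : nat) (B : nat -> set R).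
Hypothesis mB : forall j, (j <= J)%N -> measurable (B j).
Hypothesis B_anti : forall i j, (i <= j <= J)%N -> B j `<=` B i.

Local Notation cellT := {set 'I_J.+1}.
Local Notation nu := (distribution P (X i0)).

Let cell (x : R) : cellT := [set l : 'I_J.+1 | x \in B l].

(** An arbitrary [S] need not be the trace of a point. Requiring all [l <= j] makes the events
    nested on the whole of [cellT], and on actual traces it agrees with membership in [B j]. *)
Let inB (j : nat) (S : cellT) : bool :=
  [forall l : 'I_J.+1, (l <= j)%N ==> (l \in S)].

Let p (S : cellT) : R := fine (nu (cell @^-1` [set S])).

Let inB_nested i j S : (i <= j)%N -> inB j S -> inB i S.
Proof.
move=> ij /forallP jS; apply/forallP => l; apply/implyP => li.
exact: (implyP (jS l) (leq_trans li ij)).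
Qed.

Let inB_cell j x : (j <= J)%N -> inB j (cell x) = (x \in B j).
Proof.
move=> jJ; apply/forallP/idP => [/(_ (inord j))|xB l].
  by rewrite inordK ?ltnS // leqnn /= finset.in_set inordK.
apply/implyP => lj; rewrite finset.in_set; apply/mem_set.
by apply: (@B_anti l j); [rewrite lj|exact: set_mem].
Qed.

Let measurable_cell S : measurable (cell @^-1` [set S]).
Proof.
have -> : cell @^-1` [set S] = \bigcap_(l in [set: 'I_J.+1])
    (if l \in S then B l else ~` B l).
  apply/seteqP; split=> x /=.
    move=> <- l _; rewrite finset.in_set.
    by case: ifPn => [|/negP]; rewrite inE.
  move=> xS; apply/setP => l; rewrite finset.in_set; have := xS l I.
  by case: ifPn => _ xl; [exact: mem_set|exact: memNset].
apply: fin_bigcap_measurable => // l _.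
by case: ifP => _; [|apply: measurableC]; apply: mB; rewrite -ltnS.
Qed.

Let pE S : (p S)%:E = nu (cell @^-1` [set S]).
Proof. by rewrite /p fineK // fin_num_measure. Qed.

Let sum_p (A : pred cellT) :
  nu (cell @^-1` [set S | A S]) = (\sum_(S | A S) p S)%:E.
Proof.
have [_ ->] := measure_preimage_finType nu measurable_cell A.
by rewrite -sumEFin; apply: eq_bigr => S _; rewrite pE.
Qed.

Let p_ge0 S : 0 <= p S.
Proof. exact: fine_ge0. Qed.

Let p_sum1 : \sum_S p S = 1.
Proof.
apply: EFin_inj; rewrite -sum_p (_ : _ @^-1` _ = setT) ?probability_setT //.
exact/seteqP.
Qed.

Let mass_p j : (j <= J)%N -> mass p inB j = fine (nu (B j)).
Proof.
move=> jJ; apply: EFin_inj; rewrite fineK ?fin_num_measure //; last exact: mB.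
rewrite -sum_p; congr (nu _); apply/seteqP; split => x /=.
  by rewrite inB_cell // => /set_mem.
by move=> xB; rewrite inB_cell //; exact: mem_set.
Qed.

Let conf (w : T) : {ffun 'I_n -> cellT} := [ffun i => cell (X i w)].

Let conf_fiber c : conf @^-1` [set c] =
  \bigcap_(i in [set` [set: 'I_n]%SET]) (X i @^-1` (cell @^-1` [set c i])).
Proof.
apply/seteqP; split=> w /=.
  by move=> <- i _ /=; rewrite ffunE.
by move=> wc; apply/ffunP => i; rewrite ffunE; apply: wc; rewrite /= inE.
Qed.

Let measurable_conf c : measurable (conf @^-1` [set c]).
Proof.
rewrite conf_fiber; apply: fin_bigcap_measurable => // i _.
by apply: measurable_funPTI.
Qed.

(** Independence yields the product, and equality of the laws replaces each factor by [p]. *)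
Let prob_conf c : P (conf @^-1` [set c]) = (weight p c)%:E.
Proof.
have [X_indep X_ident] := X_iid.
rewrite conf_fiber X_indep // /weight -prodEFin.
apply: eq_big => [i|i _]; first by rewrite inE.
by rewrite pE; exact: X_ident.
Qed.

(** Mass and variance are constrained at the smallest event [B J] only: the maximal inequality moves
    the whole chain to its end. *)
Lemma nested_deviation (V a lam : R) : 0 <= lam <= 2^-1 ->
  2^-1 <= fine (nu (B J)) -> fine (nu (B J)) * (1 - fine (nu (B J))) <= V ->
  let E := [set w | exists2 j, (j <= J)%N &
    a < `|\sum_(i < n) (X i w \in B j)%:R - n%:R * fine (nu (B j))|] in
  measurable E /\
  (P E <= (2 * expR (8 * n%:R * lam ^+ 2 * V - lam * a))%:E)%E.
Proof.
move=> lam2 GJ GV E.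
pose e (c : {ffun 'I_n -> cellT}) := [exists l : 'I_J.+1,
  a < `|\sum_(i < n) (inB l (c i))%:R - n%:R * mass p inB l|].
have -> : E = conf @^-1` [set c | e c].
  have conf_sum w j : (j <= J)%N -> \sum_(i < n) (inB j (conf w i))%:R =
      \sum_(i < n) (X i w \in B j)%:R :> R.
    by move=> jJ; apply: eq_bigr => i _; rewrite ffunE inB_cell.
  apply/seteqP; split=> w /=.
    move=> [j jJ aj]; apply/existsP; exists (inord j).
    by rewrite inordK // conf_sum // mass_p.
  move=> /existsP[l]; have lJ : (l <= J)%N by rewrite -ltnS.
  by rewrite conf_sum // mass_p //; exists l.
have [mE ->] := measure_preimage_finType P measurable_conf e.
split=> //; rewrite (eq_bigr (fun c => (weight p c)%:E)); last first.
  by move=> c _; exact: prob_conf.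
rewrite sumEFin lee_fin.
have mJ : mass p inB J = fine (nu (B J)) by exact: mass_p.
have GJ' : 2^-1 <= mass p inB J by rewrite mJ.
have GV' : mass p inB J * (1 - mass p inB J) <= V by rewrite mJ.
apply: le_trans (mart_deviation n p_ge0 p_sum1 inB_nested a lam2 GJ' GV').
rewrite [leLHS]big_mkcond [leRHS]big_mkcond; apply: ler_sum => c _.
have w0 := weight_ge0 p_ge0 c.
case: ifP => [/existsP[l al]|_]; last by case: ifP.
rewrite ifT //; apply/existsP; exists l.
apply: le_trans (ltW al) _.
have G0 : 0 < mass p inB l.
  apply: lt_le_trans (mass_anti p_ge0 inB_nested (_ : l <= J)%N).
    by rewrite (lt_le_trans _ GJ') // invr_gt0.
  by rewrite -ltnS.
(* Up to sign the count deviates by the mass times the martingale, and the mass is at most 1, so the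
   martingale deviates at least as much. *)
have -> : \sum_(i < n) (inB l (c i))%:R - n%:R * mass p inB l =
    - (mass p inB l * mart p inB l c).
  rewrite /mart sumrB sumr_const card_ord -mulr_suml.
  by field; rewrite gt_eqF.
rewrite normrN normrM (gtr0_norm G0) ler_piMl //.
exact: mass_le1.
Qed.

End NestedDeviation.

(** Sorting by [leT] turns finitely many events into a decreasing chain. The order is abstract so as
    to serve both tails, with [<=] and with [>=]. *)
Lemma iid_chain_deviation d (T : measurableType d) (R : realType)
    (P : probability T R) (n : nat) (X : 'I_n -> {RV P >-> R}) (i0 : 'I_n)
    (leT : rel R) (B : R -> set R) (s : seq R) (V a lam : R) :
  iid X -> total leT -> transitive leT ->
  (forall x, measurable (B x)) -> (forall x y, leT x y -> B y `<=` B x) ->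
  0 <= lam <= 2^-1 ->
  {in s, forall x, let G := fine (distribution P (X i0) (B x)) in
    2^-1 <= G /\ G * (1 - G) <= V} ->
  let E := [set w | exists2 x, x \in s &
    a < `|\sum_(i < n) (X i w \in B x)%:R -
          n%:R * fine (distribution P (X i0) (B x))|] in
  measurable E /\
  (P E <= (2 * expR (8 * n%:R * lam ^+ 2 * V - lam * a))%:E)%E.
Proof.
move=> X_iid leT_total leT_tr mB B_anti lam2 sG E.
(* A chain indexed from 0 to [J] has a last event, which an empty [s] cannot supply. *)
have [s0|s_gt0] := posnP (size s).
  have -> : E = set0 by apply/seteqP; split=> w // [x]; rewrite (size0nil s0).
  by rewrite measure0 lee_fin mulr_ge0 ?expR_ge0.
pose s' := sort leT s; pose J := (size s').-1.
have s'_size : size s' = J.+1 by rewrite prednK // size_sort.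
have B_nested i j : (i <= j <= J)%N -> B (nth 0 s' j) `<=` B (nth 0 s' i).
  move=> /andP[ij jJ]; apply: B_anti.
  apply: (sorted_leq_nth leT_tr) => //.
  - by move=> x; have := leT_total x x; rewrite orbb.
  - exact: sort_sorted.
  - by rewrite inE s'_size ltnS (leq_trans ij).
  - by rewrite inE s'_size ltnS.
have [GJ GV] : let G := fine (distribution P (X i0) (B (nth 0 s' J))) in
    2^-1 <= G /\ G * (1 - G) <= V.
  by apply: sG; rewrite -(mem_sort leT) mem_nth // s'_size.
have -> : E = [set w | exists2 j, (j <= J)%N &
    a < `|\sum_(i < n) (X i w \in B (nth 0 s' j))%:R -
          n%:R * fine (distribution P (X i0) (B (nth 0 s' j)))|].
  apply/seteqP; split=> w /= [x xs xa].
    rewrite -(mem_sort leT) in xs.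
    exists (index x s'); last by rewrite nth_index.
    by rewrite -ltnS -s'_size index_mem.
  by exists (nth 0 s' x); rewrite // -(mem_sort leT) mem_nth // s'_size ltnS.
by apply: nested_deviation => //.
Qed.

(** The quadratic in [lam] is least at [t / (16 * s)]; replacing [t] there by [Num.min t s] keeps
    [lam <= 1/16]. *)
Lemma min_exponent (R : realFieldType) (t s : R) : 0 < s -> 0 <= t ->
  let lam := Num.min t s / (16 * s) in
  0 <= lam <= 2^-1 /\
  8 * lam ^+ 2 * s ^+ 2 - lam * (t * s) <=
    - (32^-1 * Num.min (t ^+ 2) (t * s)).
Proof.
move=> s0 t0; set m := Num.min t s => lam.
have m0 : 0 <= m by rewrite le_min t0 ltW.
have ms : m <= s by rewrite ge_min lexx orbT.
have mt : m <= t by rewrite ge_min lexx.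
have -> : Num.min (t ^+ 2) (t * s) = t * m by rewrite expr2 minr_pMr.
have lamE : lam * s = m / 16 by rewrite /lam; field; rewrite gt_eqF.
have lam_ge0 : 0 <= lam by rewrite divr_ge0 // mulr_ge0 // ltW.
split.
  by rewrite lam_ge0 /= ler_pdivrMr ?mulr_gt0 //; lra.
(* With [lam * s = m / 16] the left side is [m ^+ 2 / 32 - m * t / 16], at most [- (m * t) / 32] as
   [m <= t]. *)
rewrite -mulrA -exprMn mulrCA lamE; nra.
Qed.

(** * Both tails of the empirical distribution function at finitely many points *)

Section EmpiricalDeviation.
Context d (T : measurableType d) (R : realType) (P : probability T R) (n : nat).
Variables (n_gt0 : (0 < n)%N) (X : 'I_n -> {RV P >-> R}).
Hypothesis X_iid : iid X.

Local Notation nu := (distribution P (X (Ordinal n_gt0))).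

Let F (x : R) : R := fine (cdf (X (Ordinal n_gt0)) x).

Let F_ge0 x : 0 <= F x.
Proof. exact: fine_ge0. Qed.

Let F_le1 x : F x <= 1.
Proof. by rewrite -lee_fin fineK ?fin_num_measure // cdf_le1. Qed.

Let nu_gt x : fine (nu `]x, +oo[) = 1 - F x.
Proof.
apply: EFin_inj; rewrite EFinB !fineK ?fin_num_measure //.
rewrite -(cdf_ccdf_1 (X (Ordinal n_gt0)) x) [(cdf _ _ + _)%E]addeC addeK //.
by rewrite fin_num_measure.
Qed.

Let sum_gt w x : \sum_(i < n) (X i w \in `]x, +oo[%classic)%:R =
  n%:R - \sum_(i < n) (X i w <= x)%R%:R :> R.
Proof.
rewrite -[n in n%:R]card_ord -sumr_const -sumrB; apply: eq_bigr => i _.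
rewrite mem_setE in_itv /= andbT ltNge.
by case: (_ <= x); rewrite ?subrr ?subr0.
Qed.

Let sum_le w x : \sum_(i < n) (X i w \in `]-oo, x]%classic)%:R =
  \sum_(i < n) (X i w <= x)%R%:R :> R.
Proof. by apply: eq_bigr => i _; rewrite mem_setE in_itv. Qed.

(** Each of the two tails costs a factor 2, which gives the 4. The split at [F x = 1/2] leaves each
    chain with masses at least 1/2. *)
Lemma ecdf_finite_deviation (s : seq R) (V t : R) : 0 < V -> 0 <= t ->
  {in s, forall x, F x * (1 - F x) <= V} ->
  let E := [set w | exists2 x, x \in s &
    t * Num.sqrt (V / n%:R) < `|ecdf X w x - F x|] in
  measurable E /\
  (P E <= (4 * expR (- (32^-1 *
    Num.min (t ^+ 2) (t * Num.sqrt (n%:R * V)))))%:E)%E.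
Proof.
move=> V0 t0 sV E.
have n0 : 0 < n%:R :> R by rewrite ltr0n.
set q := Num.sqrt (n%:R * V).
have q0 : 0 < q by rewrite sqrtr_gt0 mulr_gt0.
have qE : q ^+ 2 = n%:R * V by rewrite sqr_sqrtr // mulr_ge0 // ltW.
have [lam2 lam_exp] := min_exponent q0 t0.
set lam := (_ / _) in lam2 lam_exp.
have {}lam_exp : 2 * expR (8 * n%:R * lam ^+ 2 * V - lam * (t * q)) <=
    2 * expR (- (32^-1 * Num.min (t ^+ 2) (t * q))).
  rewrite ler_pM2l // ler_expR (le_trans _ lam_exp) // qE.
  by rewrite lerB // le_eqVlt; apply/orP; left; apply/eqP; ring.
(* Multiplication by [n] passes to counts, with threshold [t * q] because [n * sqrt (V / n) = q]. *)
have thrE w x : (t * Num.sqrt (V / n%:R) < `|ecdf X w x - F x|) =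
    (t * q < `|\sum_(i < n) (X i w <= x)%R%:R - n%:R * F x|).
  have -> : \sum_(i < n) (X i w <= x)%R%:R - n%:R * F x =
      n%:R * (ecdf X w x - F x).
    by rewrite /ecdf mulrBr mulrA mulfV ?mul1r // gt_eqF.
  rewrite normrM (gtr0_norm n0).
  have -> : t * q = n%:R * (t * Num.sqrt (V / n%:R)).
    rewrite mulrCA; congr (_ * _).
    have -> : q = Num.sqrt (n%:R ^+ 2 * (V / n%:R)).
      by congr Num.sqrt; field; rewrite gt_eqF.
    by rewrite sqrtrM ?sqr_ge0 // sqrtr_sqr gtr0_norm.
  by rewrite ltr_pM2l.
have GV x : x \in s -> (1 - F x) * (1 - (1 - F x)) <= V.
  by move=> /sV; rewrite subKr mulrC.
(* The events [X > x] shrink as [x] grows, and [1 - F x] has the same variance as [F x]. *)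
have [mL PL] : let A := [set w | exists2 x, x \in [seq x <- s | F x <= 2^-1] &
      t * q < `|\sum_(i < n) (X i w \in `]x, +oo[%classic)%:R -
                n%:R * fine (nu `]x, +oo[)|] in
    measurable A /\
    (P A <= (2 * expR (8 * n%:R * lam ^+ 2 * V - lam * (t * q)))%:E)%E.
  apply: (@iid_chain_deviation _ _ _ _ _ X _ <=%R) => //.
  - exact: le_trans.
  - by move=> x y xy z /=; rewrite !in_itv /= !andbT; apply: le_lt_trans.
  - move=> x; rewrite mem_filter nu_gt => /andP[Fx xs].
    by split; [lra|exact: GV].
(* The events [X <= x] shrink as [x] decreases, hence the reversed order. *)
have [mR PR] : let A := [set w | exists2 x, x \in [seq x <- s | 2^-1 < F x] &
      t * q < `|\sum_(i < n) (X i w \in `]-oo, x]%classic)%:R -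
                n%:R * fine (nu `]-oo, x])|] in
    measurable A /\
    (P A <= (2 * expR (8 * n%:R * lam ^+ 2 * V - lam * (t * q)))%:E)%E.
  apply: (@iid_chain_deviation _ _ _ _ _ X _ >=%R) => //.
  - by move=> x y z xy zx; exact: le_trans zx xy.
  - by move=> x y xy z /=; rewrite !in_itv /= => zy; apply: le_trans zy xy.
  - move=> x; rewrite mem_filter => /andP[/ltW Fx xs].
    by split; [exact: Fx|exact: sV].
set EL := [set w | _] in mL PL; set ER := [set w | _] in mR PR.
have -> : E = EL `|` ER.
  have gt_le w x : `|\sum_(i < n) (X i w \in `]x, +oo[%classic)%:R -
      n%:R * fine (nu `]x, +oo[)| =
      `|\sum_(i < n) (X i w <= x)%R%:R - n%:R * F x|.
    by rewrite sum_gt nu_gt -normrN; congr (`| _ |); ring.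
  have le_le w x : `|\sum_(i < n) (X i w \in `]-oo, x]%classic)%:R -
      n%:R * fine (nu `]-oo, x])| =
      `|\sum_(i < n) (X i w <= x)%R%:R - n%:R * F x|.
    by rewrite sum_le.
  apply/seteqP; split=> w /=.
    move=> [x xs]; rewrite thrE => xw.
    have [Fx|Fx] := leP (F x) 2^-1; [left|right]; exists x => //.
    - by rewrite mem_filter Fx.
    - by rewrite gt_le.
    - by rewrite mem_filter Fx.
    - by rewrite le_le.
  move=> [] [x]; rewrite mem_filter => /andP[_ xs] xw; exists x => //.
    by rewrite thrE -gt_le.
  by rewrite thrE -le_le.
split; first exact: measurableU.
apply: le_trans (measureU2 _ mL mR) _; apply: le_trans (leeD PL PR) _.
rewrite -EFinD lee_fin (le_trans (lerD lam_exp lam_exp)) //.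
by rewrite -mulrDl -natrD.
Qed.
End EmpiricalDeviation.

(** * Reduction of the supremum to countably many points *)

Section CountableReduction.
Variables (R : realType) (x1 : \bar R).

(* Right-continuity lets the rationals see every point of an interval except
   its right endpoint. *)
Definition probe (k : nat) : R :=
  if k is k'.+1 then oapp ratr 0 (unpickle k' : option rat) else fine x1.

(** The distance is 0 at infinite points, so with [0 <= a] only real points count. Default values of
    [probe] are harmless, as each probe is tested for membership in the interval. *)
Lemma sup_distance_gtP (G F : R -> R) (x0 : \bar R) (a : R) :
  (forall x, 0 <= G x <= 1) -> (forall x, 0 <= F x <= 1) ->
  right_continuous G -> right_continuous F -> (x0 <= x1)%E -> 0 <= a ->
  a < sup_distance (extend_cdf G) (extend_cdf F) x0 x1 <->
  exists k, (x0 <= (probe k)%:E <= x1)%E /\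
    a < `|G (probe k) - F (probe k)|.
Proof.
move=> G01 F01 Gr Fr x01 a0.
have dist_le1 x : `|extend_cdf G x - extend_cdf F x| <= 1.
  case: x => [x||] /=; rewrite ?subrr ?normr0 //.
  by have /andP[? ?] := G01 x; have /andP[? ?] := F01 x; rewrite ler_norml; lra.
split=> [/sup_gt[]|[k [kx ak]]].
- by eexists; exists x0 => //=; rewrite in_itv /= lexx.
- move=> _ [[x||] /= xx <-]; last 2 first.
  + by rewrite subrr normr0 ltNge a0.
  + by rewrite subrr normr0 ltNge a0.
  move=> ax; rewrite in_itv /= in xx.
  have [xE|xx1] := eqVneq x%:E x1.
    by exists 0%N; rewrite /probe -xE /=; case/andP: xx => -> _; rewrite lexx.
  have {xx1} xx1 : (x%:E < x1)%E by rewrite lt_neqAle xx1; case/andP: xx.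
  have dist_cvg : `|G y - F y| @[y --> x^'+] --> `|G x - F x|.
    by apply: cvg_norm; apply: cvgB; [exact: Gr|exact: Fr].
  have : \forall y \near x^'+, a < `|G y - F y| by exact: cvgr_gt ax.
  rewrite /at_right near_withinE => /nbhs_ballP[e /= e0 ball_gt].
  (* [u] keeps the rational both inside the interval and within the neighbourhood given by
     right-continuity. *)
  have [u /andP[xu ux1] xue] : exists2 u : R, (x%:E < u%:E)%E && (u%:E <= x1)%E
      & u <= x + e.
    case: x1 xx1 => [y||] //; rewrite ?lte_fin => xy.
      exists (Num.min y (x + e)); last by rewrite ge_min lexx orbT.
      by rewrite lte_fin lt_min xy ltrDl e0 lee_fin ge_min lexx.
    by exists (x + e); rewrite // lte_fin ltrDl e0 leey.
  rewrite lte_fin in xu; have [r] := rat_in_itvoo xu.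
  rewrite in_itv /= => /andP[xr ru].
  have rE : probe (pickle r).+1 = ratr r by rewrite /probe pickleK.
  exists (pickle r).+1; rewrite rE; split.
    case/andP: xx => x0x _; apply/andP; split.
      by rewrite (le_trans x0x) // lee_fin ltW.
    by rewrite (le_trans _ ux1) // lee_fin ltW.
  apply: ball_gt => //; rewrite /ball /= ltr0_norm ?subr_lt0 // opprB.
  by rewrite ltrBlDl (lt_le_trans ru).
apply: lt_le_trans ak _; apply: ub_le_sup.
  by exists 1 => _ [x _ <-]; exact: dist_le1.
by exists (probe k)%:E => //=; rewrite in_itv.
Qed.

End CountableReduction.

Lemma fine_cdf_right_continuous d (T : measurableType d) (R : realType)
    (P : probability T R) (X : {RV P >-> R}) :
  right_continuous (fun x => fine (cdf X x)).
Proof.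
move=> x; apply: fine_cvg; rewrite fineK ?fin_num_measure //.
exact: cdf_right_continuous.
Qed.

(** Finitely many sample points leave a gap to the right of [x], on which the function is
    constant. *)
Lemma ecdf_right_continuous d (T : measurableType d) (R : realType)
    (P : probability T R) (n : nat) (X : 'I_n -> {RV P >-> R}) (w : T) :
  right_continuous (ecdf X w).
Proof.
move=> x; apply: cvg_near_cst.
have : \forall y \near x^'+, forall i : 'I_n, (X i w <= y) = (X i w <= x).
  apply: filter_forall => i; have [Xx|xX] := leP (X i w) x.
    near=> y; apply: le_trans Xx _; near: y; exact: nbhs_right_ge.
  near=> y; apply/negbTE; rewrite -ltNge; near: y; exact: nbhs_right_lt.
apply: filterS => y yx; rewrite /ecdf; congr (_ * _).
by apply: eq_bigr => i _; rewrite yx.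
Unshelve. all: by end_near. Qed.

Lemma ecdf_ge0_le1 d (T : measurableType d) (R : realType)
    (P : probability T R) (n : nat) (X : 'I_n -> {RV P >-> R}) (w : T) (x : R) :
  0 <= ecdf X w x <= 1.
Proof.
have [n0|n0] := posnP n.
  have inv0 : n%:R^-1 = 0 :> R by rewrite n0 invr0.
  by rewrite /ecdf inv0 mul0r lexx ler01.
rewrite /ecdf mulr_ge0 ?invr_ge0 ?sumr_ge0 //= mulrC ler_pdivrMr ?ltr0n //.
rewrite mul1r -[n in leRHS]card_ord -sumr_const; apply: ler_sum => i _.
by rewrite lern1 leq_b1.
Qed.

(** * Passage from finite grids to the supremum *)

Theorem theorem5 (R : realType) :
  exists c1 c2 : R, 0 < c1 /\ 0 < c2 /\
  forall (d : measure_display) (T : measurableType d) (P : probability T R)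
    (n : nat) (n_gt0 : (0 < n)%N) (X : 'I_n -> {RV P >-> R}),
    iid X ->
    let F := extend_cdf (fun x => fine (cdf (X (Ordinal n_gt0)) x)) in
    let Fn := fun w => extend_cdf (ecdf X w) in
    forall x0 x1 : \bar R, (x0 <= x1)%E ->
    forall t : R, 0 <= t ->
    let V := max_variance F x0 x1 in
    (P [set w | (sup_distance (Fn w) F x0 x1 > t * Num.sqrt (V / n%:R))%R]
      <= (c1 * expR (- (c2 * Num.min (t ^+ 2) (t * Num.sqrt (n%:R * V)))))%:E)%E.
Proof.
exists 4, 32^-1; do 2 split => //.
move=> d T P n n_gt0 X X_iid F Fn x0 x1 x01 t t0; cbv zeta.
set V := max_variance F x0 x1.
set a := t * Num.sqrt (V / n%:R).
have a0 : 0 <= a by rewrite mulr_ge0.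
pose f x := fine (cdf (X (Ordinal n_gt0)) x).
have f01 x : 0 <= f x <= 1.
  by rewrite fine_ge0 //= -lee_fin fineK ?fin_num_measure // cdf_le1.
have F01 x : 0 <= F x <= 1 by case: x => [x||] /=; rewrite ?f01 ?lexx ?ler01.
have leV x : (x0 <= x <= x1)%E -> F x * (1 - F x) <= V.
  move=> xx; apply: ub_le_sup; last by exists x => //=; rewrite in_itv.
  by exists 1 => _ [y _ <-]; have := F01 y; nra.
pose D := probe x1.
pose grid m := [seq D k | k <- iota 0 m & (x0 <= (D k)%:E <= x1)%E].
pose E m := [set w | exists2 x, x \in grid m & a < `|ecdf X w x - f x|].
have -> : [set w | a < sup_distance (Fn w) F x0 x1] = \bigcup_m E m.
  have supP w := sup_distance_gtP (ecdf_ge0_le1 X w) f01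
    (@ecdf_right_continuous _ _ _ _ _ X w)
    (@fine_cdf_right_continuous _ _ _ _ (X (Ordinal n_gt0))) x01 a0.
  apply/seteqP; split=> w /=.
    move=> /supP[k [kx ak]]; exists k.+1 => //; exists (D k) => //.
    by apply: map_f; rewrite mem_filter kx mem_iota /= add0n.
  move=> [m _ [_ /mapP[k + ->] ak]]; rewrite mem_filter => /andP[kx _].
  by apply/supP; exists k.
have grid_mono : {homo grid : m m' / (m <= m')%N >-> {subset m <= m'}}.
  move=> m m' mm' x /mapP[k]; rewrite mem_filter mem_iota => /and3P[kx _ km] ->.
  by apply: map_f; rewrite mem_filter kx mem_iota (leq_trans km).
have grid_V m : {in grid m, forall x, f x * (1 - f x) <= V}.
  move=> x /mapP[k]; rewrite mem_filter => /andP[kx _] ->.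
  exact: (leV (D k)%:E).
have E_dev m : measurable (E m) /\ (P (E m) <= (4 * expR (- (32^-1 *
    Num.min (t ^+ 2) (t * Num.sqrt (n%:R * V)))))%:E)%E.
  have [V0|V_le0] := ltP 0 V; first exact: ecdf_finite_deviation.
  have V0 : V = 0.
    apply/le_anti; rewrite V_le0; apply: le_trans (leV x0 _).
      by have /andP[? ?] := F01 x0; rewrite mulr_ge0 ?subr_ge0.
    by rewrite lexx.
  (* For [V = 0] the threshold is 0 and the bound is 4. Variance bound 1 with [t = 0] gives the same
     event and bound, and thereby measurability. *)
  have := @ecdf_finite_deviation _ _ _ _ _ n_gt0 X X_iid (grid m) 1 0 ltr01.
  have -> : E m = [set w | exists2 x, x \in grid m & 0 < `|ecdf X w x - f x|].
    by rewrite /E /a V0 mul0r sqrtr0 mulr0.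
  rewrite V0 mulr0 sqrtr0 !mul0r mulr0 expr0n minxx.
  rewrite (min_idPr _) ?sqr_ge0 //; apply=> // x _.
  by have /andP[? ?] := f01 x; rewrite -/(f x); nra.
have mE m : measurable (E m) by have [] := E_dev m.
have ndE : nondecreasing_seq E.
  move=> m m' mm'; apply/subsetPset => w [x xm xa]; exists x => //.
  exact: grid_mono xm.
(* Continuity from below: the union has the limit of the probabilities of the [E m], which all obey
   one bound. *)
have E_cvg := nondecreasing_cvg_mu (mu := P) mE (bigcupT_measurable _ mE) ndE.
rewrite -(cvg_lim _ E_cvg) //; apply: lime_le.
  by apply/cvg_ex; eexists; exact: E_cvg.
by apply: nearW => m; have [] := E_dev m.
Qed.
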